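(* Let $q$ be a prime power, $n>1$ an integer and $p=\mathrm{char}(\mathbb{F}_{q^n})$. Let $L(x)$ be a $2$-nilpotent linearized polynomial over $\mathbb{F}_{q^n}$ and let $k(x)\in\mathbb{F}_{q^n}[x]$ be any linearized permutation polynomial over $\mathbb{F}_{q^n}$ such that, under the ordinary polynomial composition, $k(L(x))=L(k(x))$ (so that $L(x)+k(x)$ is a permutation polynomial over $\mathbb{F}_{q^n}$). Set $s=\mathcal{O}(k)$. Suppose that the vertex associated to an element $a\in \mathbb{F}_{q^n}$ belongs to cycles of lengths $m_a$ and $m_a'$ in the functional graphs $G_k$ and $G_{L+k}$, respectively. Then: (a) $m_a'$ divides $\mathrm{lcm}(m_a,p)$ and, if $L(a)=0$, then $m_a=m_a'$. (b) If $\gcd(s,p)=1$, then $m_a'=m_a$ if $L(a)=0$, and $m_a'=p\,m_a$ otherwise.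
   Context: A polynomial $L(x)\in \mathbb{F}_{q^n}[x]$ is linearized if it has the form $L(x)=\sum_{i=0}^{k}a_ix^{q^i}$ with $a_i\in\mathbb{F}_{q^n}$. For a polynomial $f$, $f^{(d)}(x)$ denotes the ordinary polynomial composition of $f(x)$ with itself $d$ times. $L(x)\in\mathbb{F}_{q^n}[x]$ is a $2$-nilpotent linearized polynomial ($2$-NLP) over $\mathbb{F}_{q^n}$ if $L(x)$ is linearized, $L(x)\not\equiv 0\pmod{x^{q^n}-x}$ and $L^{(2)}(x)=L(L(x))\equiv 0\pmod{x^{q^n}-x}$. A polynomial $f(x)\in\mathbb{F}_{q^n}[x]$ is a permutation polynomial over $\mathbb{F}_{q^n}$ if $c\mapsto f(c)$ is a permutation of $\mathbb{F}_{q^n}$; in that case $\mathcal{O}(f)=\min\{d>0 : f^{(d)}(z)=z \text{ for all } z\in\mathbb{F}_{q^n}\}$. The functional graph $G_f$ is the directed graph with vertex set $\mathbb{F}_{q^n}$ and edges $(z,f(z))$ for $z\in\mathbb{F}_{q^n}$; for a permutation polynomial $f$ it decomposes into disjoint cycles, and $a$ belongs to a cycle of length $d$ if and only if $d$ is the least positive integer with $f^{(d)}(a)=a$. *)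

(* Defs.v *)
From HB Require Import structures.
From mathcomp Require Import all_boot all_order all_fingroup all_algebra all_field.

Set Implicit Arguments.
Unset Strict Implicit.
Unset Printing Implicit Defensive.

Import GRing.Theory.
Local Open Scope ring_scope.

Definition prime_power (q : nat) : Prop :=
  exists p e : nat, [/\ prime p, (0 < e)%N & q = (p ^ e)%N].

Definition linearized (F : fieldType) (q : nat) (f : {poly F}) : Prop :=
  exists (m : nat) (a : nat -> F), f = \sum_(i < m.+1) a i *: 'X^(q ^ i).

Definition nilpotent2_linearized (F : fieldType) (q n : nat) (L : {poly F})
    : Prop :=
  [/\ linearized q L,
      ~~ ('X^(q ^ n) - 'X %| L) &
      'X^(q ^ n) - 'X %| L \Po L].

Definition permutation_poly (F : finFieldType) (f : {poly F}) : Prop :=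
  bijective (horner f).

Definition poly_iter (F : fieldType) (d : nat) (f : {poly F}) : {poly F} :=
  iter d (fun g => f \Po g) 'X.

Definition trivial_iterate (F : finFieldType) (f : {poly F}) : pred nat :=
  fun d => (0 < d)%N && [forall z : F, (poly_iter d f).[z] == z].

Lemma horner_poly_iter (F : fieldType) (d : nat) (f : {poly F}) (z : F) :
  (poly_iter d f).[z] = iter d (horner f) z.
Proof.
by elim: d => [|d IHd]; rewrite /poly_iter /= ?hornerX // horner_comp -IHd.
Qed.

Lemma trivial_iterate_ex (F : finFieldType) (f : {poly F}) :
  permutation_poly f -> exists d, trivial_iterate f d.
Proof.
move=> /bij_inj f_inj; exists #[perm f_inj]%g; apply/andP; split.
  exact: order_gt0.
apply/forallP => z; rewrite horner_poly_iter; apply/eqP.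
transitivity (iter #[perm f_inj]%g (perm f_inj) z).
  by apply: eq_iter => w; rewrite permE.
by rewrite -permX expg_order perm1.
Qed.

Definition perm_poly_order (F : finFieldType) (f : {poly F})
    (f_perm : permutation_poly f) : nat :=
  ex_minn (trivial_iterate_ex f_perm).

Definition functional_graph (F : finFieldType) (f : {poly F}) : rel F :=
  [rel z w | w == f.[z]].

(* [ucycle e c] allows [c = [::a]] when [e a a], so a fixed point lies on a
   cycle of length 1. *)
Definition in_cycle_of_length (F : finFieldType) (e : rel F) (a : F) (m : nat)
    : Prop :=
  exists c : seq F, [/\ ucycle e c, a \in c & size c = m].

(* Main.v *)
(* Write K and N for the maps of F induced by k and L. Both are additive, they
   commute, and N o N = 0, so the binomial expansion of (K + N)^d stops after
   two terms: (K + N)^d = K^d + d N K^(d-1). In characteristic p the second term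
   dies when p divides d; this gives bijectivity and the upper bounds on cycle
   lengths. The lower bound in (b) follows by comparing the two terms: if s is
   coprime to p, a return time d of K + N at a is a multiple of m_a, so
   d N K^(d-1) a = 0 and p | d unless N a = 0. *)
Require Import Defs.
From HB Require Import structures.
From mathcomp Require Import all_boot all_order all_fingroup all_algebra all_field.

Set Implicit Arguments.
Unset Strict Implicit.
Unset Printing Implicit Defensive.

Import GRing.Theory.
Local Open Scope ring_scope.

(** Indexing by [d.+1] keeps the exponent of [K] in the second term free of truncated
    subtraction. *)
Lemma iter_addSqZero (V : zmodType) (K N : {additive V -> V}) :
    (forall x, K (N x) = N (K x)) -> (forall x, N (N x) = 0) ->
  forall d x, iter d.+1 (fun y => N y + K y) x
              = iter d.+1 K x + N (iter d K x) *+ d.+1.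
Proof.
move=> KN NN; elim=> [|d IHd] x; first by rewrite /= mulr1n addrC.
rewrite iterS IHd !raddfD !raddfMn /= NN mul0rn addr0 KN.
by rewrite addrCA -mulrS.
Qed.

Lemma iter_addSqZero_ker (V : zmodType) (K N : {additive V -> V}) :
    (forall x, K (N x) = N (K x)) ->
  forall d x, N x = 0 -> iter d (fun y => N y + K y) x = iter d K x.
Proof.
move=> KN; elim=> [|d IHd] x Nx0 //.
by rewrite !iterSr Nx0 add0r IHd // -KN Nx0 raddf0.
Qed.

Lemma iter_addSqZero_pchar (R : nzRingType) (p : nat) (K N : {additive R -> R}) :
    p \in [pchar R] ->
    (forall x, K (N x) = N (K x)) -> (forall x, N (N x) = 0) ->
  forall d x, (p %| d)%N -> iter d (fun y => N y + K y) x = iter d K x.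
Proof.
move=> pR KN NN [|d] x // p_d; rewrite iter_addSqZero // -mulr_natr.
by move: p_d; rewrite (dvdn_pcharf pR) => /eqP->; rewrite mulr0 addr0.
Qed.

Lemma pchar_nat_card (F : finFieldType) (q n : nat) :
  prime_power q -> #|F| = (q ^ n)%N -> [pchar F].-nat q.
Proof.
move=> [r [e [r_pr e_gt0 ->]]]; rewrite -expnM => cardF.
have rF := card_finPcharP cardF r_pr.
by rewrite pnatX pnatE // rF.
Qed.

(** As [q] is a power of the characteristic, each monomial is a scaled Frobenius power, hence
    additive. *)
Lemma linearized_zmod_morphism (F : fieldType) (q : nat) (f : {poly F}) :
  [pchar F].-nat q -> linearized q f -> zmod_morphism (horner f).
Proof.
move=> q_pchar [m [a ->]] x y; rewrite !horner_sum -sumrB.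
apply: eq_bigr => i _; rewrite !hornerZ !hornerXn -mulrBr; congr (_ * _).
have qi_pchar : [pchar F].-nat (q ^ i)%N by rewrite pnatX q_pchar.
apply/eqP; rewrite eq_sym subr_eq -exprDn_pchar //; apply/eqP.
by rewrite subrK.
Qed.

Lemma horner_dvd_XcardB (F : finFieldType) (f : {poly F}) (x : F) :
  'X^#|F| - 'X %| f -> f.[x] = 0.
Proof.
move=> dvdf; apply/rootP; apply: root_dvdp dvdf _; apply/rootP.
by rewrite !hornerE expf_card subrr.
Qed.

(** This turns cycle lengths into divisibility: return times are exactly the multiples of the
    length. *)
Lemma cycle_iter_eq (F : finFieldType) (f : {poly F}) (a : F) (m : nat) :
    in_cycle_of_length (functional_graph f) a m ->
  forall d, (iter d (horner f) a == a) = (m %| d)%N.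
Proof.
move=> [c [/andP[e_c uniq_c] a_c <-]] d.
have f_c : fcycle (horner f) c.
  by apply: sub_cycle e_c => x y; rewrite /= eq_sym.
have ord_a := order_cycle f_c uniq_c a_c.
have iter_mul e : iter (e * size c) (horner f) a = a.
  elim: e => [|e IHe] //; rewrite mulSn iterD IHe -ord_a.
  exact: (iter_order_cycle f_c).
have c_gt0 : (0 < size c)%N by case: c a_c {e_c uniq_c f_c ord_a iter_mul}.
(* Only [d %% size c] steps remain; being fewer than the order of [a], they return to [a] only if
   there are none. *)
rewrite {1}(divn_eq d (size c)) addnC iterD iter_mul eq_sym.
by rewrite -(findex_eq0 (horner f)) findex_iter // ord_a ltn_mod.
Qed.

Theorem theorem4 (q n p : nat) (F : finFieldType)
    (hq : prime_power q) (hn : (1 < n)%N)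
    (hF : #|F| = (q ^ n)%N) (hp : p \in [pchar F])
    (L k : {poly F})
    (hL : nilpotent2_linearized q n L)
    (hk : linearized q k) (hkperm : permutation_poly k)
    (hkL : k \Po L = L \Po k) :
  let s := perm_poly_order hkperm in
  permutation_poly (L + k) /\
  forall (a : F) (m m' : nat),
    in_cycle_of_length (functional_graph k) a m ->
    in_cycle_of_length (functional_graph (L + k)) a m' ->
    ((m' %| lcmn m p)%N /\ (L.[a] = 0 -> m = m')) /\
    (coprime s p ->
       (L.[a] = 0 -> m' = m) /\ (L.[a] <> 0 -> m' = (p * m)%N)).
Proof.
move=> s.
have q_pchar := pchar_nat_card hq hF.
case: hL => L_lin _ LL0.
pose N : {additive F -> F} := HB.pack (horner L)
  (GRing.isZmodMorphism.Build F F (horner L)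
     (linearized_zmod_morphism q_pchar L_lin)).
pose K : {additive F -> F} := HB.pack (horner k)
  (GRing.isZmodMorphism.Build F F (horner k)
     (linearized_zmod_morphism q_pchar hk)).
have KN x : K (N x) = N (K x) by rewrite /= -!horner_comp hkL.
have NN x : N (N x) = 0.
  by rewrite /= -horner_comp horner_dvd_XcardB // hF.
have Lk : horner (L + k) =1 (fun x => N x + K x) by move=> x; rewrite hornerD.
have [s_gt0 Ks] : (0 < s)%N /\ forall x, iter s K x = x.
  rewrite /s /perm_poly_order; case: ex_minnP => t /andP[t_gt0 /forallP tP] _.
  by split=> // x; rewrite -horner_poly_iter; apply/eqP/tP.
have iterM d : iter d (horner (L + k)) =1 iter d (fun x => N x + K x).
  exact: eq_iter.
have iterMp d x : (p %| d)%N -> iter d (horner (L + k)) x = iter d K x.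
  by move=> p_d; rewrite iterM (iter_addSqZero_pchar hp).
have p_gt0 := prime_gt0 (pcharf_prime hp).
have iterK_s e x : iter (e * s) K x = x.
  by elim: e => [|e IHe] //; rewrite mulSn iterD IHe Ks.
split.
  (* The iterate of order [p * s] equals that of [K], which is the identity by [iterK_s], so one
     step fewer gives a left inverse. *)
  apply: injF_bij; apply: (@can_inj _ _ _ (iter (p * s).-1 (horner (L + k)))).
  move=> x; rewrite -iterSr prednK ?muln_gt0 ?p_gt0 //.
  by rewrite iterMp ?dvdn_mulr.
move=> a m m' /cycle_iter_eq ka /cycle_iter_eq Ma.
have m'_lcm : (m' %| lcmn m p)%N.
  by rewrite -Ma iterMp ?dvdn_lcmr // ka dvdn_lcml.
have ker_eq : L.[a] = 0 -> m = m'.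
  move=> La0; have iterMK d : iter d (horner (L + k)) a = iter d K a.
    by rewrite iterM iter_addSqZero_ker.
  by apply/eqP; rewrite eqn_dvd -ka -iterMK Ma dvdnn -Ma iterMK ka dvdnn.
split; [by [] | move=> co_sp; split=> [/ker_eq //| /eqP La_neq0]].
have m_s : (m %| s)%N by rewrite -ka Ks.
have co_mp : coprime m p := coprime_dvdl m_s co_sp.
have m_m' : (m %| m')%N.
  (* The time [p * m'] is a return time of [L + k] and a multiple of [p], hence also a return time
     of [k]. *)
  rewrite -(Gauss_dvdr m' co_mp) -ka -[iter _ _ _]iterMp ?dvdn_mulr //.
  by rewrite Ma dvdn_mull.
have p_m' : (p %| m')%N.
  case: m' => [|d] in Ma m_m' {m'_lcm ker_eq} *; first exact: dvdn0.
  have Kda : iter d.+1 K a = a by apply/eqP; rewrite ka.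
  have := Ma d.+1; rewrite dvdnn iterM iter_addSqZero // Kda -subr_eq0.
  rewrite addrAC subrr add0r -mulr_natr mulf_eq0 -(dvdn_pcharf hp) => /orP[/eqP Nd0|//].
  (* If [N] kills the [d]-th [K]-iterate of [a], it kills the next one too, and that is [a]
     itself. *)
  case/eqP: La_neq0; change (N a = 0).
  by rewrite -Kda iterS -KN Nd0 raddf0.
(* Coprimality gives [m * p %| m']; the converse goes through the lcm bound of part (a). *)
apply/eqP; rewrite eqn_dvd mulnC Gauss_dvd // m_m' p_m' !andbT.
by apply: (dvdn_trans m'_lcm); rewrite dvdn_lcm dvdn_mulr ?dvdn_mull.
Qed.
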